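(* If $\alpha\in\overline{\mathbb{Z}}$ satisfies $\langle\alpha,\alpha\rangle<2\sqrt{\mathrm{e}}$, where $\mathrm{e}=\exp(1)$, then $\alpha$ has only finitely many decompositions.
   Context: $\overline{\mathbb{Q}}$ is an algebraic closure of $\mathbb{Q}$ and $\overline{\mathbb{Z}}\subseteq\overline{\mathbb{Q}}$ is the ring of algebraic integers. $\overline{\mathbb{Q}}$ carries the inner product $$\langle\alpha,\beta\rangle=\frac{1}{[\mathbb{Q}(\alpha,\beta):\mathbb{Q}]}\sum_{\sigma:\mathbb{Q}(\alpha,\beta)\to\mathbb{C}}\sigma(\alpha)\cdot\overline{\sigma(\beta)},$$ where the sum ranges over all field embeddings of $\mathbb{Q}(\alpha,\beta)$ in $\mathbb{C}$. A decomposition of $\alpha\in\overline{\mathbb{Z}}$ is a pair $(\beta,\gamma)\in\overline{\mathbb{Z}}^2$ such that $\alpha=\beta+\gamma$ and $\langle\beta,\gamma\rangle\geq 0$. *)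

(* Defs.v *)
From HB Require Import structures.
From mathcomp Require Import all_boot all_order all_algebra all_field.
From mathcomp Require Import complex.
From mathcomp Require Import all_classical all_reals sequences exp.
Set Implicit Arguments.
Unset Strict Implicit.
Unset Printing Implicit Defensive.
Import Order.TTheory GRing.Theory Num.Theory.
Local Open Scope classical_set_scope.
Local Open Scope ring_scope.

(* The algebraic closure of the rationals is algC, its ring of algebraic
   integers is Aint, and the complex numbers are R[i] with R : realType. *)

Definition field_embeddings (R : realType) (K : fieldExtType rat) :
    set (K -> R[i]) :=
  [set sigma | zmod_morphism sigma /\ monoid_morphism sigma].
Arguments field_embeddings : clear implicits.

(* K, together with iota : K -> algC, is the number field Q(alpha, beta):
   iota maps the two entries a, b of s to alpha, beta, and a, b generate K.
   The sum over a classical set is that of fsbigop, which is 0 by convention on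
   an infinite support; field_embeddings R K is finite, so this is harmless. *)
Definition inner (R : realType) (alpha beta : algC) : R[i] :=
  let: existT K (existT iota (exist2 s _ _)) :=
    num_field_exists [:: alpha; beta] in
  (\dim {:K})%:R^-1 *
    \sum_(sigma \in field_embeddings R K) sigma s`_0 * (sigma s`_1)^*.

(* The order of R[i] only compares numbers with equal imaginary parts, so
   0 <= z says that z is real and nonnegative.  Every inner product is real,
   since complex conjugation permutes the embeddings. *)
Definition decomposition (R : realType) (alpha : algC) (bc : algC * algC) :
    Prop :=
  [/\ bc.1 \in Aint, bc.2 \in Aint, alpha = bc.1 + bc.2
    & 0 <= inner R bc.1 bc.2].

(* Main.v *)
From HB Require Import structures.
Require Import Defs.
From mathcomp Require Import all_boot all_order all_algebra all_field.
From mathcomp Require Import complex.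
From mathcomp Require Import all_classical all_reals sequences exp.
From mathcomp Require Import ring lra zify.
Set Implicit Arguments.
Unset Strict Implicit.
Unset Printing Implicit Defensive.
Import Order.TTheory GRing.Theory Num.Theory.
Local Open Scope classical_set_scope.
Local Open Scope complex_scope.
Local Open Scope ring_scope.

(** A pair (b, a - b) has nonnegative inner product exactly when b lies in the
ball with centre a/2 and squared radius r0 = <a,a>/4 (sphere of diameter
[0, a]), so the theorem says that this ball contains finitely many algebraic
integers as soon as r0 < sqrt(e)/2.

Fix a Galois number field E containing a and b, with group G, and an embedding
phi of E in the complex numbers.  Every inner product of elements of E is the
average over g in G of phi(g x) times the conjugate of phi(g y) (innerE);
unlike the definition, this formula uses the same field for all pairs.  So
b in the ball means that the average over g of |phi(g(b - a/2))|^2 is at most r0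
(decomposition_mean).

The main point is to bound the relative degree n = [Q(a,b) : Q(a)].  Let
b_1, ..., b_n be the conjugates of b over Q(a), and V their Vandermonde product.
It is a nonzero algebraic integer, so the product over g of |phi(g V)| is a
positive integer (galNorm_ge1).  On the other hand V does not change when a/2,
which is fixed by the automorphisms over Q(a), is subtracted from every b_i, and
for complex numbers x_1, ..., x_n and t > 0 one has
  |prod_(i<j) (x_j - x_i)|^2 t^(n(n-1)/2) <= prod_(k<n) k! e^(t sum_i |x_i|^2)
(vandermonde_le_expR): apply Hadamard's inequality to the matrix with rows
(x_i^k sqrt(t^k / k!))_k, whose squared lengths are partial sums of the series
of e^(t |x_i|^2).  The weight e^(-t |x|^2) is the one that suits a constraint on
the mean of |x|^2: asymptotically the optimal x_i fill a disc uniformly.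
Multiplying over g gives t^(n(n-1)/2) <= prod_(k<n) k! e^(t n r) for r >= r0
(discriminant_bound).  With t = n/(2r) and Stirling's estimate, the logarithm of
the two sides compares to (n^2/2) (ln(2r) - 1/2) >= - O(n ln n), which bounds n
when 2r < sqrt(e) (bounded_of_exp_growth).

Once n is bounded, so are the degree of b and, since each single conjugate
contributes at least 1/deg to the averages, all conjugates of b.  Hence the
coefficients of its minimal polynomial are bounded integers, and b belongs to a
finite set (northcott). *)

Local Notation normc := ComplexField.Normc.normc.

(** * The real-valued norm of a complex number *)

Section NormC.
Variable R : realType.
Implicit Types z : R[i].

Lemma normCE z : `|z| = (normc z)%:C. Proof. by []. Qed.

Lemma normc_ge0 z : 0 <= normc z.
Proof. by rewrite -lecR -normCE normr_ge0. Qed.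

Lemma normc_prod (I : Type) (r : seq I) (P : pred I) (F : I -> R[i]) :
  normc (\prod_(i <- r | P i) F i) = \prod_(i <- r | P i) normc (F i).
Proof.
apply: complexI; rewrite -normCE normr_prod rmorph_prod /=.
by apply: eq_bigr => i _.
Qed.

Lemma normcX z k : normc (z ^+ k) = normc z ^+ k.
Proof. by apply: complexI; rewrite -normCE normrX rmorphXn. Qed.

Lemma ler_normcD z z' : normc (z + z') <= normc z + normc z'.
Proof. by rewrite -lecR rmorphD /= -!normCE ler_normD. Qed.

End NormC.

(** * Hadamard's inequality and the weighted Vandermonde bound *)

(** Gram-Schmidt writes A = L U with U unitary and L triangular, so that |det A|
is the product of the |L i i|, while row i of A is as long as row i of L. *)
Lemma hadamard (C : numClosedFieldType) n (A : 'M[C]_n) :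
  `|\det A| ^+ 2 <= \prod_(i < n) \sum_(j < n) `|A i j| ^+ 2.
Proof.
pose ct m (M : 'M[C]_m) := map_mx Num.conj M^T.
have ctM m (M N : 'M[C]_m) : ct m (M *m N) = ct m N *m ct m M.
  by rewrite /ct trmx_mul map_mxM.
have gramE (M : 'M[C]_n) i : (M *m ct n M) i i = \sum_j `|M i j| ^+ 2.
  by rewrite mxE; apply: eq_bigr => j _; rewrite !mxE normCK.
pose U := schmidt A.
have unitU : U \is spectral.unitarymx by apply: schmidt_unitarymx.
have UUt : U *m ct n U = 1%:M by apply/unitarymxP.
pose L := A *m ct n U.
have defA : A = L *m U by rewrite /L mulmxKtV.
have trigL : is_trig_mx L.
  apply/is_trig_mxP => i j ltij.
  have /sub_sumsmxP[u /rowP Di] := row_schmidt_sub A i.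
  have -> : L i j = ((row i A) *m ct n U) 0 j.
    by rewrite -row_mul [RHS]mxE.
  have -> : row i A = \sum_(k < n | (k <= i)%N) u k *m <<row k U>>%MS.
    by apply/rowP.
  rewrite mulmx_suml summxE big1 // => k leki.
  have /submxP[w ->] : (u k *m <<row k U>> <= row k U)%MS.
    by rewrite (submx_trans (submxMl _ _)) // genmxE.
  rewrite -mulmxA -row_mul UUt.
  rewrite mxE big1 // => l _; rewrite !mxE.
  by rewrite (_ : k == j = false) ?mulr0 //; apply/eqP => ekj;
     move: ltij; rewrite -ekj ltnNge leki.
have detU : `|\det U| ^+ 2 = 1.
  rewrite normCK; have := congr1 determinant UUt.
  by rewrite det_mulmx det1 /ct det_map_mx det_tr.
rewrite {1}defA det_mulmx normrM exprMn detU mulr1 det_trig // normr_prod.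
rewrite -prodrXl; apply: ler_prod => i _; rewrite exprn_ge0 //=.
rewrite -[leRHS]gramE defA ctM mulmxA -[L *m U *m _]mulmxA UUt mulmx1 gramE.
by rewrite (bigD1 i) //= lerDl sumr_ge0 // => j _; rewrite exprn_ge0.
Qed.

Lemma exp_sum_le_expR (R : realType) (x : R) n : 0 <= x ->
  \sum_(k < n) x ^+ k / k`!%:R <= expR x.
Proof.
move=> x0; have -> : \sum_(k < n) x ^+ k / k`!%:R = series (exp_coeff x) n.
  by rewrite /series /= big_mkord.
apply: nondecreasing_cvgn_le; last exact: is_cvg_series_exp_coeff.
move=> m p lemp; rewrite /series /= (big_cat_nat (leq0n m) lemp) /= lerDl.
by apply: sumr_ge0 => k _; rewrite exp_coeff_ge0.
Qed.

(** The coefficients c k make the squared length of each row a partial sum of an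
exponential series; they are the normalising factors of the monomials for the
Gaussian weight. *)
Lemma vandermonde_le_expR (R : realType) n (x : 'I_n -> R[i]) (t : R) :
  0 < t ->
  normc (\prod_(i < n) \prod_(j < n | (i < j)%N) (x j - x i)) ^+ 2
     * t ^+ 'C(n, 2)
  <= (\prod_(k < n) k`!%:R) * expR (t * \sum_(i < n) normc (x i) ^+ 2).
Proof.
move=> t0; set V := \prod_(i < n) _.
pose c (k : 'I_n) : R := Num.sqrt (t ^+ k / k`!%:R).
have fact_gt0R k : 0 < k`!%:R :> R by rewrite ltr0n fact_gt0.
have c2 k : c k ^+ 2 = t ^+ k / k`!%:R.
  by rewrite sqr_sqrtr // divr_ge0 ?exprn_ge0 ?ltW.
pose M := \matrix_(i < n, j < n) (x i ^+ j * (c j)%:C).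
have detM : \det M = V * (\prod_k c k)%:C.
  have -> : M = (Vandermonde n (\row_j x j))^T *m diag_mx (\row_j (c j)%:C).
    by apply/matrixP => i j; rewrite mul_mx_diag !mxE.
  rewrite det_mulmx det_tr det_Vandermonde det_diag rmorph_prod; congr (_ * _).
    by apply: eq_bigr => i _; apply: eq_bigr => j _; rewrite !mxE.
  by apply: eq_bigr => i _; rewrite mxE.
have c2prod : (\prod_k c k) ^+ 2 = t ^+ 'C(n, 2) / \prod_(k < n) k`!%:R.
  rewrite -prodrXl (eq_bigr _ (fun k _ => c2 k)) prodf_div prodrXr.
  by rewrite -bin2_sum big_mkord.
have fact_prod_gt0 : 0 < \prod_(k < n) k`!%:R :> R by apply: prodr_gt0.
have := hadamard M; rewrite detM normrM exprMn !normCE -!rmorphXn -rmorphM /=.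
have normcR (u : R) : normc u%:C ^+ 2 = u ^+ 2.
  by rewrite /= expr0n /= addr0 sqr_sqrtr ?sqr_ge0.
rewrite normcR c2prod mulrA => le1.
rewrite -ler_pdivrMl // [leLHS]mulrC -lecR.
apply: le_trans le1 _; rewrite mulr_sumr expR_sum.
rewrite rmorph_prod; apply: ler_prod => i _.
rewrite sumr_ge0 /= => [|j _]; last by rewrite exprn_ge0.
apply: le_trans (_ :
    (\sum_(k < n) (t * normc (x i) ^+ 2) ^+ k / k`!%:R)%:C <= _).
  rewrite rmorph_sum; apply: ler_sum => j _; rewrite mxE normCE -rmorphXn lecR.
  rewrite ComplexField.Normc.normcM exprMn normcR c2 normcX exprMn -!exprM.
  by rewrite [(j * 2)%N]mulnC mulrCA mulrA.
by rewrite lecR exp_sum_le_expR // mulr_ge0 ?sqr_ge0 // ltW.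
Qed.

(** * The degree bound: growth of products of factorials *)

Section FactorialGrowth.
Variable R : realType.

Lemma ln_succ_ge n : (0 < n)%N ->
  ln (n%:R : R) * n.+1%:R + 1 <= ln n.+1%:R * n.+1%:R.
Proof.
move=> n0; have n0R : 0 < n%:R :> R by rewrite ltr0n.
have := @le_ln1Dx R (- n.+1%:R^-1).
rewrite ltrN2 invf_lt1 ?ltr0n // ltr1n => /(_ n0).
have -> : 1 - n.+1%:R^-1 = n%:R / n.+1%:R :> R.
  by rewrite -natr1; field; rewrite natr1 pnatr_eq0.
rewrite ln_div ?posrE ?ltr0n // => ln_le.
rewrite -ler_pdivrMr ?ltr0n // mulrDl mul1r mulfK ?pnatr_eq0 //.
by move: (ln _) (ln _) (_^-1) ln_le => u v w; lra.
Qed.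

(** This is k! <= e k (k/e)^k, weaker than Stirling's formula by a factor of
order sqrt k only. *)
Lemma ln_fact_le n : (0 < n)%N ->
  ln (n`!%:R : R) <= (n%:R + 1) * ln n%:R - n%:R + 1.
Proof.
elim: n => // [[_ _|n IH _]]; first by rewrite (_ : 1`! = 1)%N // ln1; lra.
rewrite factS natrM lnM ?posrE ?ltr0n ?fact_gt0 //.
have := IH isT; have := @ln_succ_ge n.+1 isT.
set l := ln _; set l' := ln _; set f := ln _ => le3 le2.
have e: n.+2%:R = n.+1%:R + 1 :> R by rewrite natr1.
rewrite e in le3 *; set m : R := n.+1%:R in le2 le3 *; nra.
Qed.

(** Only the terms (n^2/2) ln n and - (3/4) n^2 matter below; the term
(n/2) ln n and the linear term are chosen so that the induction closes. *)
Lemma sum_ln_fact_le n : (0 < n)%N ->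
  \sum_(k < n) ln (k`!%:R : R) <=
  n%:R * (n%:R + 1) / 2 * ln n%:R - 3 / 4 * n%:R ^+ 2 + 7 / 4 * n%:R.
Proof.
elim: n => // [[_ _|n IH _]].
  by rewrite big_ord1 fact0 ln1 mulr0; lra.
rewrite big_ord_recr /=.
have := IH isT; have := @ln_succ_ge n.+1 isT; have := @ln_fact_le n.+1 isT.
have e: n.+2%:R = n.+1%:R + 1 :> R by rewrite natr1.
set l := ln n.+1%:R; set l' := ln n.+2%:R; set S := \sum_(_ < _) _.
set f := ln _ => le1 le2 le3.
have : (l * n.+2%:R + 1) * n.+2%:R <= l' * n.+2%:R * n.+2%:R.
  by rewrite ler_wpM2r.
rewrite e; set m : R := n.+1%:R in le1 le2 le3 *.
have : 1 <= m by rewrite ler1n.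
nra.
Qed.

End FactorialGrowth.

Lemma natr_bin2 (F : numFieldType) n :
  'C(n, 2)%:R = n%:R * (n%:R - 1) / 2 :> F.
Proof.
elim: n => [|n IH]; first by rewrite !mul0r.
by rewrite binS bin1 natrD IH -natr1; field.
Qed.

(** For t = n/(2r) the inequality says, after division by n, that
2 d (n - 1) <= ln n + 3/2 where 4 d = 1/2 - ln(2r) is positive: this is where
the constant sqrt(e) comes from. *)
Lemma bounded_of_exp_growth (R : realType) (r : R) :
  0 < r -> 2 * r < Num.sqrt (expR 1) ->
  exists N, forall n, (0 < n)%N ->
    (forall t : R, 0 < t ->
      t ^+ 'C(n, 2) <= (\prod_(k < n) k`!%:R) * expR (t * (n%:R * r))) ->
    (n <= N)%N.
Proof.
move=> r0 r_small; have r20 : 0 < 2 * r by lra.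
pose lam := ln (2 * r).
have lamlt : lam < 1 / 2.
  have -> : 1 / 2 = ln (Num.sqrt (expR 1)) :> R.
    have : ln (Num.sqrt (expR 1) ^+ 2 : R) = 1.
      by rewrite sqr_sqrtr ?expR_ge0 // expRK.
    by rewrite lnXn ?sqrtr_gt0 ?expR_gt0 //; lra.
  by rewrite ltr_ln ?posrE ?sqrtr_gt0 ?expR_gt0.
pose d := (1 / 2 - lam) / 4.
have d0 : 0 < d by rewrite /d; lra.
pose K := 2 * d + 3 / 2 - ln d.
exists (Num.bound (`|K / d|)) => n n0 /(_ (n%:R / (2 * r))).
have n0R : 0 < n%:R :> R by rewrite ltr0n.
have n1R : 1 <= n%:R :> R by rewrite ler1n.
rewrite divr_gt0 // => /(_ isT) main.
have fact_gt0R k : 0 < k`!%:R :> R by rewrite ltr0n fact_gt0.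
have P0 : 0 < \prod_(k < n) k`!%:R :> R by apply: prodr_gt0.
have lnP : ln (\prod_(k < n) k`!%:R : R) = \sum_(k < n) ln (k`!%:R : R).
  elim: (n) => [|m IH]; first by rewrite !big_ord0 ln1.
  by rewrite !big_ord_recr /= lnM ?posrE ?prodr_gt0 // IH.
have {main} : ln ((n%:R / (2 * r)) ^+ 'C(n, 2)) <=
    ln ((\prod_(k < n) k`!%:R) * expR (n%:R / (2 * r) * (n%:R * r))).
  by rewrite ler_ln ?posrE ?mulr_gt0 ?exprn_gt0 ?divr_gt0 ?expR_gt0.
rewrite lnXn ?divr_gt0 // lnM ?posrE ?expR_gt0 // lnP expRK ln_div ?posrE //.
have -> : n%:R / (2 * r) * (n%:R * r) = n%:R ^+ 2 / 2 by field; lra.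
rewrite -[_ *+ 'C(n, 2)]mulr_natr natr_bin2.
(* ln n <= d n - ln d, which grows half as fast as 2 d n *)
have := @sum_ln_fact_le R n n0; have := ln_sublinear (mulr_gt0 d0 n0R).
rewrite [ln (d * _)]lnM ?posrE //.
have -> : ln (2 * r) = 1 / 2 - 4 * d by rewrite -/lam /d; lra.
move=> ltl leS main; have leB := ltW (archi_boundP (normr_ge0 (K / d))).
rewrite -(ler_nat R); apply: le_trans leB; apply: le_trans (ler_norm _).
rewrite ler_pdivlMr // /K.
move: (\sum_(k < n) _) (ln n%:R) (ln d) ltl leS main => S l ld ltl leS main.
have : n%:R * (2 * d * (n%:R - 1) - l - 3 / 2) <= 0 by nra.
rewrite pmulr_rle0 //; lra.
Qed.

(** * Embeddings and normal closures of number fields *)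

Lemma galois_rat (E : splittingFieldType rat) : galois 1 {:E}.
Proof.
apply/and3P; split; [exact: sub1v | | exact: normalFieldf].
apply/separableP => y _; apply: pcharf0_separable => p.
by rewrite pchar_lalg pchar_num.
Qed.

Lemma rmorph_horner_rat (K : fieldExtType rat) (A : fieldType)
    (f : {rmorphism K -> A}) p x :
  f (map_poly (in_alg K) p).[x] = (map_poly ratr p).[f x].
Proof.
rewrite -horner_map -map_poly_comp; congr _.[_].
by apply: eq_map_poly => a; rewrite /= alg_num_field fmorph_rat.
Qed.

Lemma horner_rat_adjoin (K : fieldExtType rat) (x y : K) :
  y \in <<1; x>>%VS -> exists p, y = (map_poly (in_alg K) p).[x].
Proof.
move=> /Fadjoin_poly_eq <-.
by have /polyOver1P[p ->] := Fadjoin_polyOver 1%AS x y; exists p.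
Qed.

(** The morphism sends p(x) to p(z), for p with rational coefficients; the
hypothesis on roots makes this independent of p. *)
Lemma rmorphism_of_root (K : fieldExtType rat) (L : numFieldType)
    (x : K) (z : L) :
  <<1; x>>%VS = fullv ->
  (forall p, root (map_poly (in_alg K) p) x -> root (map_poly ratr p) z) ->
  exists f : {rmorphism K -> L}, f x = z.
Proof.
move=> genx rootz.
have polyx y : {p | y = (map_poly (in_alg K) p).[x]}.
  by apply: cid; apply: horner_rat_adjoin; rewrite genx memvf.
pose f y := (map_poly ratr (sval (polyx y))).[z].
have fE p : f (map_poly (in_alg K) p).[x] = (map_poly ratr p).[z].
  rewrite /f; case: (polyx _) => q /= Dq; apply/eqP.
  rewrite -subr_eq0 -hornerN -hornerD -rmorphB -rootE rootz //.
  by rewrite rootE rmorphB hornerD hornerN Dq subrr.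
have fB : zmod_morphism f.
  move=> u v; have [p ->] := polyx u; have [q ->] := polyx v.
  by rewrite -hornerN -hornerD -rmorphB !fE rmorphB hornerD hornerN.
have fM : monoid_morphism f.
  split=> [|u v]; first by have := fE 1; rewrite !rmorph1 !hornerC.
  have [p ->] := polyx u; have [q ->] := polyx v.
  by rewrite -hornerM -rmorphM !fE rmorphM hornerM.
pose fa := GRing.isZmodMorphism.Build K L f fB.
pose fm := GRing.isMonoidMorphism.Build K L f fM.
pose fR : {rmorphism _ -> _} := HB.pack f fa fm.
by exists fR; have := fE 'X; rewrite !map_polyX !hornerX.
Qed.

Lemma exists_rmorphism (K : fieldExtType rat) (C : numClosedFieldType) :
  exists f : {rmorphism K -> C}, True.
Proof.
have sepK : separable 1 {:K}.
  apply/separableP => y _; apply: pcharf0_separable => p.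
  by rewrite pchar_lalg pchar_num.
have genx := eq_adjoin_separable_generator sepK (sub1v _).
move: (separable_generator 1%AS {:K}) genx => x genx.
have /polyOver1P[q Dq] := minPolyOver 1%AS x.
have [z rootz] : exists z : C, root (map_poly ratr q) z.
  apply/closed_rootP; rewrite size_map_poly.
  have := congr1 (fun p : {poly K} => size p) Dq.
  by rewrite size_minPoly size_map_poly => <-; rewrite eqSS -lt0n.
have [||f _] := @rmorphism_of_root K C x z; [by rewrite -genx | | by exists f].
move=> p /(minPoly_dvdp (alg_polyOver 1%AS p)); rewrite Dq dvdp_map.
move=> /dvdpP[u ->].
by rewrite rmorphM rootM rootz orbT.
Qed.

(** Adjoin all the roots of the minimal polynomials of the entries of s. *)
Lemma exists_normal_closure (s : seq algC) :
  exists (E : splittingFieldType rat) (iota : {rmorphism E -> algC})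
    (t : seq E),
    map iota t = s.
Proof.
pose q x := sval (minCpolyP x).
have minqE x : map_poly ratr (q x) = minCpoly x.
  by rewrite /q; case: minCpolyP => p /= [].
pose rs (x : algC) := sval (closed_field_poly_normal (minCpoly x)).
have rsE x : minCpoly x = \prod_(z <- rs x) ('X - z%:P).
  rewrite /rs; case: closed_field_poly_normal => r /= {1}->.
  by rewrite (monicP (minCpoly_monic x)) scale1r.
have [E [iota [ss Dss genE]]] := num_field_exists (flatten (map rs s)).
have prodE :
    map_poly (in_alg E) (\prod_(x <- s) q x) = \prod_(y <- ss) ('X - y%:P).
  apply: (map_poly_inj iota); rewrite [RHS]rmorph_prod /=.
  under [RHS]eq_bigr do rewrite map_polyXsubC.
  rewrite -(big_map iota xpredT (fun z => 'X - z%:P)) Dss.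
  rewrite big_flatten big_map /=.
  rewrite -map_poly_comp [LHS](_ : _ = map_poly ratr (\prod_(x <- s) q x)).
    by rewrite rmorph_prod; apply: eq_bigr => x _; rewrite /= minqE rsE.
  by apply: eq_map_poly => a; rewrite /= alg_num_field fmorph_rat.
have splitE : FieldExt_isSplittingField _ E.
  constructor; exists (\prod_(y <- ss) ('X - y%:P)).
    by rewrite -prodE; apply: alg_polyOver.
  by exists ss; rewrite ?eqpxx.
pose ES := HB.pack_for (splittingFieldType rat) E splitE.
exists ES, iota; rewrite /=.
have : {subset s <= map iota ss}.
  move=> x xs; rewrite Dss; apply/flattenP; exists (rs x); first exact: map_f.
  by rewrite -root_prod_XsubC -rsE root_minCpoly.
elim: (s) => [_|x s' IH sub]; first by exists [::].
have [y yin|t Dt] := IH; first by apply: sub; rewrite inE yin orbT.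
have /mapP[y _ ->] : x \in map iota ss by apply: sub; rewrite inE eqxx.
by exists (y :: t); rewrite /= Dt.
Qed.

(** * Galois conjugates and the inner product *)

Section GaloisConjugates.

Variable E : splittingFieldType rat.
Local Notation G := 'Gal({:E} / 1)%g.

Lemma mem_gal_rat (g : gal_of {:E}) : g \in G.
Proof. by rewrite gal_kHom ?sub1v // k1AHom. Qed.

Lemma mem_gal_adjoin (x : E) (g : gal_of {:E}) :
  (g \in 'Gal({:E} / <<1; x>>)%g) = (g x == x).
Proof.
rewrite gal_kHom ?subvf //; apply/kAHomP/eqP => [|gx y xy].
  by apply; apply: memv_adjoin.
have /Fadjoin_polyP[p Qp ->] := xy.
by rewrite -horner_map (fixedPoly_gal (sub1v _) (mem_gal_rat g)) //= gx.
Qed.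

Lemma card_gal_fiber (x : E) (g : gal_of {:E}) :
  #|[pred k : gal_of {:E} | k x == g x]| = #|'Gal({:E} / <<1; x>>)%g|.
Proof.
rewrite -(fingroup.card_rcoset 'Gal({:E} / <<1; x>>)%g g); apply: eq_card => k.
rewrite inE fingroup.mem_rcoset mem_gal_adjoin galM ?memvf //.
rewrite -(inj_eq (fmorph_inj (g^-1)%g)) /=.
by rewrite -[X in _ == X](galM _ _ (memvf x)) fingroup.mulgV gal_id.
Qed.

(** One automorphism is chosen for each conjugate of x over K, so that sums over
conjugates become sums over automorphisms. *)
Lemma gal_transversal (K : {subfield E}) (x : E) :
  exists r : seq (gal_of {:E}),
    [/\ {subset r <= 'Gal({:E} / K)%g}, uniq [seq h x | h : gal_of {:E} <- r],
        minPoly K x = \prod_(h <- r) ('X - (h x)%:P)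
      & size r = adjoin_degree K x].
Proof.
have galK : galois K {:E}.
  by apply: galoisS (galois_rat E); rewrite sub1v subvf.
have [r [subr Ur minE]] := galois_factors (subvf K) galK x (memvf x).
exists r; split=> //; first exact/fintype.subsetP.
  by rewrite minE big_map.
by apply: succn_inj; rewrite -size_minPoly minE size_prod_XsubC size_map.
Qed.

(** The map g |-> g x from G to the conjugates of x has fibres of equal size,
the cosets of the stabiliser of x. *)
Lemma sum_gal_transversal (V : nmodType) (f : E -> V) (x : E)
    (r : seq (gal_of {:E})) :
  uniq [seq h x | h : gal_of {:E} <- r] ->
  minPoly 1 x = \prod_(h <- r) ('X - (h x)%:P) ->
  \sum_(g in G) f (g x) =
  (\sum_(h <- r) f (h x)) *+ #|'Gal({:E} / <<1; x>>)%g|.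
Proof.
move=> Ur minE; rewrite -sumrMnl.
have -> : \sum_(g in G) f (g x) =
    \sum_(g : gal_of {:E}) \sum_(h <- r | h x == g x) f (h x).
  apply: eq_big => [g|g _]; first exact: mem_gal_rat.
  have gr : g x \in [seq h x | h : gal_of {:E} <- r].
    rewrite -root_prod_XsubC big_map -minE.
    by rewrite root_minPoly_gal ?sub1v ?memvf ?mem_gal_rat.
  rewrite -(big_map (fun h : gal_of {:E} => h x) (pred1 (g x)) f).
  by rewrite -big_filter filter_pred1_uniq // big_seq1.
rewrite (exchange_big_dep xpredT) //=; apply: eq_bigr => h _.
rewrite -(card_gal_fiber x h) -sumr_const; apply: eq_bigl => k.
by rewrite inE eq_sym.
Qed.

Lemma card_gal (x : E) :
  #|G| = (adjoin_degree 1 x * #|'Gal({:E} / <<1; x>>)%g|)%N.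
Proof.
have galx : galois <<1; x>> {:E}.
  by apply: galoisS (galois_rat E); rewrite sub1v subvf.
rewrite -(galois_dim (galois_rat E)) -(galois_dim galx).
rewrite adjoin_degreeE !dimv1 !divn1 mulnC divnK //.
by rewrite field_dimS // subvf.
Qed.

End GaloisConjugates.

Lemma minCpoly_minPoly (K : fieldExtType rat) (iota : {rmorphism K -> algC})
    (x : K) :
  minCpoly (iota x) = map_poly iota (minPoly 1 x).
Proof.
have iotaQ (p : {poly rat}) :
    map_poly iota (map_poly (in_alg K) p) = map_poly ratr p.
  rewrite -map_poly_comp; apply: eq_map_poly => a.
  by rewrite /= alg_num_field fmorph_rat.
have [q [Dq monq rootq]] := minCpolyP (iota x).
have /polyOver1P[m Dm] := minPolyOver 1%AS x.
have rootE p : root (map_poly ratr p) (iota x) = root (map_poly (in_alg K) p) x.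
  by rewrite -iotaQ fmorph_root.
rewrite Dq Dm iotaQ; congr (map_poly _ _); apply/eqP.
have monm : m \is monic by rewrite -(map_monic (in_alg K)) -Dm monic_minPoly.
rewrite -eqp_monic // /eqp -rootq rootE -Dm root_minPoly /=.
rewrite -(dvdp_map (in_alg K)) -Dm minPoly_dvdp ?alg_polyOver //.
by rewrite -rootE rootq.
Qed.

Lemma size_minCpoly (K : fieldExtType rat) (iota : {rmorphism K -> algC})
    (x : K) :
  size (minCpoly (iota x)) = (adjoin_degree 1 x).+1.
Proof. by rewrite (minCpoly_minPoly iota x) size_map_poly size_minPoly. Qed.

(** Choose t and t' generating the same number field inside E and inside the
field K of the definition.  Both sums become sums over the conjugates of t: an
embedding of K is determined by its value at t', which can be the image under
phi of any conjugate of t, and the sum over G counts each conjugate equally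
often. *)
Lemma innerE (R : realType) (E : splittingFieldType rat)
    (iota : {rmorphism E -> algC}) (phi : {rmorphism E -> R[i]}) (x y : E) :
  inner R (iota x) (iota y) =
  #|'Gal({:E} / 1)%g|%:R^-1 *
    \sum_(g in 'Gal({:E} / 1)%g) phi (g x) * (phi (g y))^*%R.
Proof.
rewrite /inner; case: num_field_exists => K [iK [s Ds genK]].
have : size s = 2 by rewrite -(size_map iK) Ds.
case: s Ds genK => [|x' [|y' []]] //= [Dx Dy] genK _.
have [z [a Dz] [[|p [|q []]] // [Dp Dq]]] := algC_PET [:: iota x; iota y].
rewrite !big_ord_recl big_ord0 /= addr0 in Dz.
pose t := x *+ a ord0 + y *+ a (lift ord0 ord0).
pose t' := x' *+ a ord0 + y' *+ a (lift ord0 ord0).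
have iotat : iota t = z by rewrite Dz rmorphD !rmorphMn.
have iKt : iK t' = z by rewrite Dz rmorphD !rmorphMn /= Dx Dy.
have xE : x = (map_poly (in_alg E) p).[t].
  by apply: (fmorph_inj iota); rewrite rmorph_horner_rat iotat.
have yE : y = (map_poly (in_alg E) q).[t].
  by apply: (fmorph_inj iota); rewrite rmorph_horner_rat iotat.
have x'E : x' = (map_poly (in_alg K) p).[t'].
  by apply: (fmorph_inj iK); rewrite rmorph_horner_rat iKt Dx.
have y'E : y' = (map_poly (in_alg K) q).[t'].
  by apply: (fmorph_inj iK); rewrite rmorph_horner_rat iKt Dy.
have gent : <<1; t'>>%VS = fullv.
  apply/eqP; rewrite eqEsubv subvf -genK; apply/Fadjoin_seqP; split.
    exact: sub1v.
  have memt r : (map_poly (in_alg K) r).[t'] \in <<1; t'>>%VS.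
    apply/Fadjoin_polyP; exists (map_poly (in_alg K) r) => //.
    exact: alg_polyOver.
  by move=> w; rewrite !inE => /orP[] /eqP ->; rewrite ?x'E ?y'E memt.
have same_root r :
    root (map_poly (in_alg K) r) t' = root (map_poly (in_alg E) r) t.
  rewrite !rootE -(fmorph_eq0 iK) -(fmorph_eq0 iota) !rmorph_horner_rat.
  by rewrite iKt iotat.
have [r [_ Ur minE szr]] := gal_transversal 1%AS t.
have dimK : \dim {:K} = size r.
  rewrite szr; apply: succn_inj; rewrite -(size_minCpoly iota) iotat -iKt.
  by rewrite (size_minCpoly iK) adjoin_degreeE gent dimv1 divn1.
pose F v : R[i] := (map_poly ratr p).[v] * ((map_poly ratr q).[v])^*.
have FE (h : gal_of {:E}) : phi (h x) * (phi (h y))^* = F (phi (h t)).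
  have hE u :
      phi (h (map_poly (in_alg E) u).[t]) = (map_poly ratr u).[phi (h t)].
    exact: (rmorph_horner_rat (phi \o h)).
  by rewrite {1}xE {1}yE !hE.
under [in RHS]eq_bigr do rewrite FE.
rewrite (sum_gal_transversal (fun v => F (phi v)) Ur minE).
rewrite (card_gal t) -szr -dimK -[_ *+ #|_|]mulr_natr natrM invfM.
rewrite mulrACA mulVf ?mulr1;
  last by rewrite pnatr_eq0 -lt0n fingroup.cardG_gt0.
congr (_ * _).
transitivity (\sum_(v <- [seq phi (h t) | h : gal_of {:E} <- r]) F v);
  last first.
  by rewrite big_map.
have Uphi : uniq [seq phi (h t) | h : gal_of {:E} <- r].
  rewrite (map_comp phi (fun h : gal_of {:E} => h t)) map_inj_uniq //.
  exact: fmorph_inj.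
rewrite (fsbig_seq _ _ Uphi).
have hornerS (f : K -> R[i]) : field_embeddings R K f ->
    forall r, f (map_poly (in_alg K) r).[t'] = (map_poly ratr r).[f t'].
  case=> fB fM r0.
  pose fa := GRing.isZmodMorphism.Build K R[i] f fB.
  pose fm := GRing.isMonoidMorphism.Build K R[i] f fM.
  pose fR : {rmorphism _ -> _} := HB.pack f fa fm.
  exact: (rmorph_horner_rat fR).
rewrite (reindex_fsbig (fun f : K -> R[i] => f t') (field_embeddings R K)).
  apply: eq_fsbigr => f /set_mem femb.
  by rewrite x'E y'E !hornerS.
have /polyOver1P[m Dm] := minPolyOver 1%AS t.
have mE :
    map_poly ratr m =
    \prod_(v <- [seq phi (h t) | h : gal_of {:E} <- r]) ('X - v%:P).
  transitivity (map_poly phi (minPoly 1 t)).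
    rewrite Dm -map_poly_comp; apply: eq_map_poly => b.
    by rewrite /= alg_num_field fmorph_rat.
  rewrite minE rmorph_prod big_map.
  by apply: eq_bigr => h _; rewrite /= map_polyXsubC.
split.
- move=> f femb /=; rewrite -root_prod_XsubC -mE rootE -hornerS //.
  suff /eqP -> : root (map_poly (in_alg K) m) t'.
    case: femb => fB _; have := fB 0 0; rewrite !subr0 => f0.
    by rewrite -(subrr (f 0)) -fB subrr.
  by rewrite same_root -Dm root_minPoly.
- move=> f g /set_mem femb /set_mem gemb /= fg; apply/funext => w.
  have /horner_rat_adjoin[u ->] : w \in <<1; t'>>%VS by rewrite gent memvf.
  by rewrite !hornerS // fg.
- move=> v /=; rewrite -root_prod_XsubC -mE => rootv.
  have [|f ft] := @rmorphism_of_root K R[i] t' v gent.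
    move=> u; rewrite same_root => /(minPoly_dvdp (alg_polyOver 1%AS u)).
    rewrite Dm dvdp_map => /dvdpP[w ->].
    by rewrite rmorphM rootM rootv orbT.
  exists f => //; split; first exact: rmorphB.
  by split; [exact: rmorph1 | exact: rmorphM].
Qed.

(** * The bound on the discriminant of a point of the ball *)

(** By polarisation, u (v - u)^* has real part |v|^2/4 - |u - v/2|^2. *)
Lemma sphere_of_inner_ge0 (C : numClosedFieldType) (I : finType) (P : pred I)
    (u v : I -> C) :
  0 <= \sum_(i in P) u i * (v i - u i)^* ->
  \sum_(i in P) `|u i - v i / 2| ^+ 2 <= (\sum_(i in P) `|v i| ^+ 2) / 4.
Proof.
set w := \sum_(i in _) _ => w0.
have wr : w^* = w by apply: CrealP; exact: ger0_real.
have -> : \sum_(i in P) `|u i - v i / 2| ^+ 2 =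
    (\sum_(i in P) `|v i| ^+ 2) / 4 - (w + w^*) / 2.
  rewrite /w rmorph_sum mulr_suml -big_split mulr_suml -sumrB.
  apply: eq_bigr => i _.
  rewrite !normCK !(rmorphB, rmorphM) /= !conjCK fmorphV rmorph_nat.
  by field.
by rewrite gerBl wr divr_ge0 // addr_ge0.
Qed.

Section GaloisOrbits.
Variables (R : realType) (E : splittingFieldType rat).
Variables (iota : {rmorphism E -> algC}) (phi : {rmorphism E -> R[i]}).
Local Notation G := 'Gal({:E} / 1)%g.

Lemma Aint_gal (g : gal_of {:E}) x : iota x \in Aint -> iota (g x) \in Aint.
Proof.
move=> intx; apply: (@root_monic_Aint (minCpoly (iota x))) => //.
  rewrite (minCpoly_minPoly iota x) fmorph_root.
  by rewrite root_minPoly_gal ?sub1v ?memvf ?mem_gal_rat.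
exact: minCpoly_monic.
Qed.

(** The norm of x is an algebraic integer fixed by G, hence a nonzero rational
integer. *)
Lemma galNorm_ge1 x : x != 0 -> iota x \in Aint ->
  1 <= \prod_(g in G) normc (phi (g x)).
Proof.
move=> nz intx; rewrite -normc_prod -lecR -normCE.
have -> : \prod_(g in G) phi (g x) = phi (galNorm 1 {:E} x).
  by rewrite rmorph_prod.
have /vlineP[a Da] := mem_galNorm (galois_rat E) (memvf x).
have : iota (galNorm 1 {:E} x) \in Num.int.
  apply: Cint_rat_Aint; first by rewrite Da alg_num_field fmorph_rat Crat_rat.
  by rewrite rmorph_prod rpred_prod // => g _; apply: Aint_gal.
rewrite Da alg_num_field !fmorph_rat => /intrP[m Dm].
have Dam : a = m%:~R.
  by have : ratr a = ratr m%:~R :> algC;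
    [rewrite Dm ratr_int | move/fmorph_inj].
have nzm : m != 0.
  have : galNorm 1 {:E} x != 0 by rewrite galNorm_eq0.
  by apply: contraNneq => m0; rewrite Da Dam m0 scale0r.
by rewrite Dam ratr_int -intr_norm rmorph1 ler1z; move: nzm; lia.
Qed.

(** Each conjugate of x appears in |G| / deg x terms of the sum over G. *)
Lemma conjugate_bound (r : R) x (g : gal_of {:E}) :
  \sum_(h in G) normc (phi (h x)) ^+ 2 <= #|G|%:R * r ->
  normc (phi (g x)) ^+ 2 <= (adjoin_degree 1 x)%:R * r.
Proof.
have [hs [_ Ur minE _]] := gal_transversal 1%AS x.
rewrite (sum_gal_transversal (fun v => normc (phi v) ^+ 2) Ur minE).
rewrite (card_gal x).
rewrite natrM mulrAC -[_ *+ _]mulr_natr ler_pM2r; last first.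
  by rewrite ltr0n fingroup.cardG_gt0.
apply: le_trans.
have : g x \in [seq h x | h : gal_of {:E} <- hs].
  rewrite -root_prod_XsubC big_map -minE.
  by rewrite root_minPoly_gal ?sub1v ?memvf ?mem_gal_rat.
move=> gx.
rewrite -(big_map (fun h : gal_of {:E} => h x) xpredT
  (fun v => normc (phi v) ^+ 2)).
by rewrite (big_rem _ gx) /= lerDl sumr_ge0 // => v _; rewrite sqr_ge0.
Qed.

(** The square of V is the discriminant of b over Q(a), so this compares its
norm, at least 1, with the Vandermonde bound at every g in G.  In the exponent,
summing over both the conjugates h i and the automorphisms g repeats the sum
over G n times. *)
Lemma discriminant_bound (r : R) (a b : E) (t : R) :
  let n := adjoin_degree <<1; a>> b in
  iota b \in Aint ->
  \sum_(g in G) normc (phi (g (b - a / 2))) ^+ 2 <= #|G|%:R * r ->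
  0 < t ->
  t ^+ 'C(n, 2) <= (\prod_(k < n) k`!%:R) * expR (t * (n%:R * r)).
Proof.
move=> n intb meanr t0; set A : R := \prod_(k < n) _.
have A0 : 0 < A by apply: prodr_gt0 => k _; rewrite ltr0n fact_gt0.
have G0 : (0 < #|G|)%N by rewrite fingroup.cardG_gt0.
have [hs [stabh Uh _ szh]] := gal_transversal <<1; a>>%AS b.
pose h (i : 'I_n) := nth 1%g hs i.
have ha i : h i a = a.
  by apply/eqP; rewrite -mem_gal_adjoin stabh // mem_nth // szh.
have hc i : h i (b - a / 2) = h i b - a / 2.
  by rewrite rmorphB fmorph_div /= ha rmorph_nat.
pose V := \prod_(i < n) \prod_(j < n | (i < j)%N) (h j b - h i b).
have nzV : V != 0.
  apply/prodf_neq0 => i _; apply/prodf_neq0 => j ltij.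
  have nthE (k : 'I_n) : h k b = nth 0 [seq h b | h : gal_of {:E} <- hs] k.
    by rewrite (nth_map 1%g) // szh.
  by rewrite subr_eq0 !nthE nth_uniq ?size_map ?szh ?ltn_ord // gtn_eqF.
have intV : iota V \in Aint.
  rewrite rmorph_prod rpred_prod // => i _.
  rewrite rmorph_prod rpred_prod // => j _.
  by rewrite rmorphB rpredB // Aint_gal.
have := galNorm_ge1 nzV intV; set N := \prod_(g in G) _ => N1.
rewrite -(@ler_pXn2r _ #|G|) ?nnegrE ?exprn_ge0 ?mulr_ge0 ?expR_ge0 ?(ltW t0)
  ?(ltW A0) //.
apply: (@le_trans _ _
    (\prod_(g in G) (normc (phi (g V)) ^+ 2 * t ^+ 'C(n, 2)))).
  rewrite big_split /= prodr_const prodrXl -/N ler_peMl ?exprn_ege1 //.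
  by rewrite !exprn_ge0 // ltW.
apply: (@le_trans _ _ (\prod_(g in G)
    (A * expR (t * \sum_(i < n) normc (phi (g (h i (b - a / 2)))) ^+ 2)))).
  apply: ler_prod => g _; rewrite mulr_ge0 ?sqr_ge0 ?exprn_ge0 ?(ltW t0) //=.
  apply: le_trans (vandermonde_le_expR (fun i => phi (g (h i (b - a / 2)))) t0).
  rewrite le_eqVlt; apply/orP; left; apply/eqP; congr (normc _ ^+ 2 * _).
  rewrite !rmorph_prod; apply: eq_bigr => i _.
  rewrite !rmorph_prod; apply: eq_bigr => j _.
  by rewrite -!rmorphB !hc; congr (phi (g _)); ring.
rewrite big_split /= prodr_const exprMn ler_pM2l ?exprn_gt0 // -expR_sum.
rewrite -expRM_natl ler_expR -mulr_sumr mulrCA ler_pM2l //.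
rewrite exchange_big /=.
have -> : #|G|%:R * (n%:R * r) = \sum_(i < n) #|G|%:R * r.
  by rewrite sumr_const card_ord -[RHS]mulr_natl mulrCA.
apply: ler_sum => i _; apply: le_trans meanr.
rewrite le_eqVlt; apply/orP; left; apply/eqP.
rewrite [RHS](reindex_inj (fingroup.mulgI (h i))) /=.
by apply: eq_big => g; rewrite ?mem_gal_rat // galM ?memvf.
Qed.

Lemma inner_selfE (a : E) :
  inner R (iota a) (iota a) =
  ((\sum_(g in G) normc (phi (g a)) ^+ 2) / #|G|%:R)%:C.
Proof.
rewrite (innerE iota phi) mulrC rmorphM fmorphV rmorph_nat rmorph_sum.
by congr (_ * _); apply: eq_bigr => g _; rewrite -normCK normCE rmorphXn.
Qed.

Lemma decomposition_mean (a b : E) :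
  0 <= inner R (iota b) (iota (a - b)) ->
  \sum_(g in G) normc (phi (g (b - a / 2))) ^+ 2 <=
    #|G|%:R * (complex.Re (inner R (iota a) (iota a)) / 4).
Proof.
have G0 : 0 < #|G|%:R :> R[i] by rewrite ltr0n fingroup.cardG_gt0.
rewrite inner_selfE (innerE iota phi) pmulr_rge0 ?invr_gt0 //.
move=> le0; have := @sphere_of_inner_ge0 R[i] _ (mem G)
  (fun g : gal_of {:E} => phi (g b)) (fun g : gal_of {:E} => phi (g a)).
have -> : \sum_(g in mem G) phi (g b) * (phi (g a) - phi (g b))^* =
    \sum_(g in G) phi (g b) * (phi (g (a - b)))^*.
  by apply: eq_bigr => g _; rewrite !rmorphB.
have normcE (F : gal_of {:E} -> R[i]) :
    \sum_(g in G) `|F g| ^+ 2 = (\sum_(g in G) normc (F g) ^+ 2)%:C.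
  by rewrite rmorph_sum; apply: eq_bigr => g _; rewrite normCE rmorphXn.
move=> /(_ le0); rewrite !normcE.
have div4 (s : R) : s%:C / 4 = (s / 4)%:C by rewrite rmorphM fmorphV rmorph_nat.
rewrite div4 lecR /=.
rewrite mulrA [_%:R * _]mulrC divfK ?pnatr_eq0 -?lt0n ?fingroup.cardG_gt0 //.
apply: le_trans; rewrite le_eqVlt; apply/orP; left; apply/eqP.
apply: eq_bigr => g _.
by rewrite !rmorphB fmorph_div rmorph_nat fmorph_div rmorph_nat.
Qed.

End GaloisOrbits.

(** * Finiteness for bounded degree and bounded conjugates *)

Lemma coef_prod_XsubC_le (F : numDomainType) (B : F) (s : seq F) k : 0 <= B ->
  {in s, forall z, `|z| <= B} ->
  `|(\prod_(z <- s) ('X - z%:P))`_k| <= (1 + B) ^+ size s.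
Proof.
move=> B0; elim: s k => [|z s IH] k bnd.
  by rewrite big_nil coef1 expr0; case: eqP; rewrite ?normr1 ?normr0 ?ler01.
have {}IH k' := IH k' (fun y ys => bnd y (mem_behead (s := z :: s) ys)).
have zB : `|z| <= B by apply: bnd; rewrite inE eqxx.
rewrite big_cons mulrBl coefB coefXM coefCM exprS mulrDl mul1r.
apply: le_trans (ler_normB _ _) _; rewrite normrM lerD //; last exact: ler_pM.
by case: eqP => _; rewrite ?normr0 ?IH // exprn_ge0 // addr_ge0 // ler01.
Qed.

(** The minimal polynomial of x is one of finitely many integer polynomials. *)
Lemma northcott (D M : nat) :
  finite_set [set x : algC | [/\ x \in Aint, (size (minCpoly x) <= D)%N
    & forall k, `|(minCpoly x)`_k| <= M%:R]].
Proof.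
pose P (f : {ffun 'I_D -> 'I_(M + M).+1}) : {poly algC} :=
  \poly_(i < D) (if insub i is Some j then (f j)%:R - M%:R else 0).
apply: (@sub_finite_set _ _
  (\bigcup_(f in [set f | P f != 0]) [set x | root (P f) x])).
  move=> x [/polyOverP/= intx szx bndx].
  have val k : exists i : 'I_(M + M).+1, (minCpoly x)`_k = i%:R - M%:R.
    have /intrP[m Dm] := intx k; have := bndx k.
    rewrite Dm -intr_norm -[M%:R]/((M%:Z)%:~R) ler_int => lemM.
    have lt : (absz (m + M%:Z)%R < (M + M).+1)%N.
      by move: lemM; case: m {Dm} => m; lia.
    exists (Ordinal lt) => /=.
    rewrite -[RHS]/(((absz (m + M%:Z)%R)%:Z)%:~R - (M%:Z)%:~R) -rmorphB.
    by congr (_%:~R); move: lemM {Dm lt}; lia.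
  pose f := [ffun i : 'I_D => sval (cid (val i))].
  have Pf : P f = minCpoly x.
    apply/polyP => k; rewrite coef_poly; case: ltnP => [ltk|lek].
      by rewrite insubT ffunE; case: cid.
    by rewrite nth_default // (leq_trans szx).
  exists f => /=; first by rewrite Pf monic_neq0 // minCpoly_monic.
  by rewrite Pf root_minCpoly.
apply: bigcup_finite => [|f /= nzP]; first exact: finite_finset.
have [s Ds] := closed_field_poly_normal (P f).
apply: (@sub_finite_set _ _ [set` s]) => [x /=|]; last exact: finite_seq.
by rewrite Ds rootZ ?lead_coef_eq0 // root_prod_XsubC.
Qed.

Lemma minCpoly_coef_le (R : realType) (E : splittingFieldType rat)
    (iota : {rmorphism E -> algC}) (phi : {rmorphism E -> R[i]})
    (B : R) (M : nat) (b : E) k :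
  0 <= B -> (1 + B) ^+ adjoin_degree 1 b <= M%:R ->
  (forall g : gal_of {:E}, normc (phi (g b)) <= B) ->
  `|(minCpoly (iota b))`_k| <= M%:R.
Proof.
move=> B0 leM bnd; have [hs [_ Ur minE szh]] := gal_transversal 1%AS b.
have /polyOver1P[q Dq] := minPolyOver 1%AS b.
have {}Dq : minPoly 1 b = map_poly (in_alg E) q := Dq.
have -> : (minCpoly (iota b))`_k = ratr q`_k.
  rewrite (minCpoly_minPoly iota b) Dq -map_poly_comp coef_map /=.
  by rewrite alg_num_field fmorph_rat.
(* the coefficients are rational, so they have the same size in both fields *)
rewrite -ratr_norm -(ratr_nat algC) ler_rat -(ler_rat R[i]) ratr_norm ratr_nat.
have -> : ratr q`_k =
    (\prod_(z <- [seq phi (h b) | h : gal_of {:E} <- hs]) ('X - z%:P))`_k.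
  have <- : map_poly phi (minPoly 1 b) =
      \prod_(z <- [seq phi (h b) | h : gal_of {:E} <- hs]) ('X - z%:P).
    rewrite minE rmorph_prod big_map.
    by apply: eq_bigr => h _; rewrite /= map_polyXsubC.
  by rewrite Dq -map_poly_comp coef_map /= alg_num_field fmorph_rat.
apply: le_trans (coef_prod_XsubC_le (B := B%:C) _ _ _) _.
- by rewrite ler0c.
- by move=> _ /mapP[h _ ->]; rewrite normCE lecR.
rewrite size_map szh -(rmorph_nat (real_complex R)) -(rmorph1 (real_complex R)).
by rewrite -rmorphD -rmorphXn lecR.
Qed.

(** * Decompositions *)

Lemma adjoin_degree_tower (K : fieldExtType rat) (a b c : K) :
  c \in <<<<1; a>>; b>>%VS ->
  (adjoin_degree 1 c <= adjoin_degree 1 a * adjoin_degree <<1; a>> b)%N.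
Proof.
move=> cab; have := dim_Fadjoin 1%AS c; rewrite dimv1 muln1 => <-.
apply: leq_trans (_ : \dim <<<<1; a>>; b>> <= _)%N.
  by apply: dimvS; apply/FadjoinP; split => //; apply: sub1v.
by rewrite dim_Fadjoin /= dim_Fadjoin dimv1 muln1 mulnC.
Qed.

(** It bounds a modulus by its square without square roots. *)
Lemma le_add1_sqr (R : realFieldType) (x : R) : x <= 1 + x ^+ 2.
Proof. nra. Qed.

Theorem theorem1p4 (R : realType) (alpha : algC)
  (alpha_int : alpha \in Aint)
  (alpha_small : inner R alpha alpha < (2 * Num.sqrt (expR 1))%:C) :
  finite_set [set bc : algC * algC | decomposition R alpha bc].
Proof.
pose d := (size (minCpoly alpha)).-1.
pose r0 := complex.Re (inner R alpha alpha) / 4.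
pose e2 : R := Num.sqrt (expR 1) / 2.
have e2_gt0 : 0 < e2 by rewrite divr_gt0 // sqrtr_gt0 expR_gt0.
have r0_lt : r0 < e2.
  move: alpha_small; rewrite ltcE /= /r0 /e2 => /andP[_].
  by rewrite -/(complex.Re _); move: (complex.Re _) (Num.sqrt _) => u v; lra.
(* r0 may vanish, whereas the choice t = n/(2r) needs a positive r *)
pose r := Num.max r0 (e2 / 2).
have r_gt0 : 0 < r by rewrite lt_max orbC divr_gt0.
have r0r : r0 <= r by rewrite le_max lexx.
have [|N degN] := bounded_of_exp_growth r_gt0.
  have : r < e2 by rewrite gt_max r0_lt ltr_pdivrMr // ltr_pMr // ltr1n.
  by rewrite /e2; lra.
(* |b'| <= |b' - a'/2| + |a'|/2 for conjugates, with moduli at most 1 + their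
   squares; the mean of |a'|^2 is 4 r0 *)
pose B := (1 + (d * N)%:R * r) + (1 + d%:R * (4 * r)).
have B0 : 0 <= B by rewrite !addr_ge0 ?mulr_ge0 // ltW.
pose M := Num.bound ((1 + B) ^+ (d * N)).
have M_bound : (1 + B) ^+ (d * N) <= M%:R.
  by apply/ltW/archi_boundP; rewrite exprn_ge0 // addr_ge0.
apply: (@sub_finite_set _ _
  [set (b, alpha - b) | b in [set x : algC | [/\ x \in Aint,
     (size (minCpoly x) <= (d * N).+1)%N
     & forall k, `|(minCpoly x)`_k| <= M%:R]]]); last first.
  exact/finite_image/northcott.
move=> [beta gamma] [/= intb _ Dalpha inner_ge0].
exists beta => /=; last by congr pair; rewrite Dalpha addrAC subrr add0r.
have [E [iota [t Dt]]] := exists_normal_closure [:: alpha; beta].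
case: t Dt => [|a [|b []]] //= [Da Db].
have [phi _] := exists_rmorphism E R[i].
have Dc : gamma = iota (a - b).
  by rewrite rmorphB Da Db Dalpha addrAC subrr add0r.
rewrite -Db Dc in inner_ge0.
have := decomposition_mean phi inner_ge0; rewrite Da -/r0 => mean_le.
have G0 : (0 < #|'Gal({:E} / 1)%g|)%N by rewrite fingroup.cardG_gt0.
have mean_r : \sum_(g in 'Gal({:E} / 1)%g) normc (phi (g (b - a / 2))) ^+ 2
    <= #|'Gal({:E} / 1)%g|%:R * r.
  by apply: le_trans mean_le _; rewrite ler_pM2l // ltr0n.
have mean_a : \sum_(g in 'Gal({:E} / 1)%g) normc (phi (g a)) ^+ 2
    <= #|'Gal({:E} / 1)%g|%:R * (4 * r).
  have := inner_selfE iota phi a; rewrite Da => Dr0.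
  have {}Dr0 : r0 = (\sum_(g in 'Gal({:E} / 1)%g) normc (phi (g a)) ^+ 2)
      / #|'Gal({:E} / 1)%g|%:R / 4.
    by rewrite /r0 Dr0.
  rewrite -ler_pdivrMl ?ltr0n // [leLHS]mulrC -ler_pdivrMl // [leLHS]mulrC.
  by rewrite -Dr0.
have dE : adjoin_degree 1 a = d by rewrite /d -Da (size_minCpoly iota).
have nN : (adjoin_degree <<1; a>> b <= N)%N.
  apply: degN => // t t0.
  apply: (discriminant_bound (iota := iota) _ mean_r t0).
  by rewrite Db.
have deg_le c : c \in <<<<1; a>>; b>>%VS -> (adjoin_degree 1 c <= d * N)%N.
  by move=> /adjoin_degree_tower /leq_trans -> //; rewrite dE leq_mul2l nN orbT.
have memb : b \in <<<<1; a>>; b>>%VS by apply: memv_adjoin.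
have mema : a \in <<<<1; a>>; b>>%VS by apply/subvP_adjoin/memv_adjoin.
split=> //.
  by rewrite -Db (size_minCpoly iota) ltnS deg_le.
move=> k; rewrite -Db; apply: (@minCpoly_coef_le R E iota phi B M b k B0).
  apply: le_trans M_bound; rewrite ler_weXn2l ?deg_le //.
  by rewrite lerDl.
move=> g.
have -> : phi (g b) = phi (g (b - a / 2)) + phi (g a) / 2.
  by rewrite !rmorphB !fmorph_div !rmorph_nat subrK.
apply: le_trans (ler_normcD _ _) _; rewrite lerD //.
  apply: le_trans (le_add1_sqr _) _; rewrite lerD2l.
  apply: le_trans (conjugate_bound g mean_r) _.
  rewrite ler_wpM2r ?(ltW r_gt0) //.
  by rewrite ler_nat deg_le // rpredB ?rpredM ?rpredV ?rpred_nat.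
apply: (@le_trans _ _ (normc (phi (g a)))).
  rewrite ComplexField.Normc.normcM ler_piMr ?normc_ge0 // -lecR -normCE.
  by rewrite normfV normr_nat invf_le1 ?ler1n.
apply: le_trans (le_add1_sqr _) _; rewrite lerD2l -dE.
exact: conjugate_bound.
Qed.
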